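(* Let $J$ be a positive integer, let $\mathrm{B}$ be a symplectic form on a vector space $\mathcal{V}$ over $\mathbb{F}_2$ of dimension $2J$, and let $\mathcal{S}\subseteq\mathcal{V}$ satisfy $\mathrm{B}(v_1,v_2)=1$ for all $v_1,v_2\in\mathcal{S}$ with $v_1\neq v_2$. Then $\#(\mathcal{S})\leq 2J+1$. Consequently, the binder $\operatorname{bin}(\Phi)$ of the symplectic ETF $\Phi$ corresponding to $\mathrm{B}$ (the case $P=2$) is empty unless $J\in\{1,2\}$. When $J=2$ (and $P=2$), $\operatorname{bin}(\Phi)$ is nonempty and so forms a BIBD. It consists of all shifts (translates $v+\mathcal{K}$, $v\in\mathcal{V}$) of any subset $\mathcal{K}$ of $\mathcal{V}$ of the form \[ \{\,0,\ v_1,\ v_2,\ v_1+v_2+v_3,\ v_1+v_2+v_4,\ v_1+v_2+v_3+v_4\,\}, \] where $(v_1,v_2,v_3,v_4)$ is any symplectic basis for $\mathcal{V}$.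
   Context: A symplectic form on a vector space $\mathcal{V}$ is a bilinear form $\mathrm{B}$ that is alternating ($\mathrm{B}(v,v)=0$ for all $v$) and nondegenerate. A symplectic basis of a $4$-dimensional $\mathcal{V}$ over $\mathbb{F}_2$ is a basis $(v_1,v_2,v_3,v_4)$ with $\mathrm{B}(v_1,v_2)=\mathrm{B}(v_3,v_4)=1$ and $\mathrm{B}(v_i,v_j)=0$ for all other pairs $i<j$. ETFs: a finite sequence $(\varphi_n)_{n\in\mathcal{N}}$ in a real Hilbert space ($\mathcal{N}$ finite, nonempty) is an equiangular tight frame (ETF) if (i) $\|\varphi_n\|^2=S$ for all $n$ for some $S>0$, (ii) $|\langle\varphi_{n_1},\varphi_{n_2}\rangle|^2=C$ for all $n_1\neq n_2$ for some $C>0$, and (iii) for some $A>0$, $\sum_n\langle\varphi_n,y\rangle\varphi_n=Ay$ for all $y$ in its span. For nonempty $\mathcal{K}\subseteq\mathcal{N}$, $(\varphi_n)_{n\in\mathcal{K}}$ is a regular simplex if it is an ETF whose span has dimension $\#(\mathcal{K})-1$. The binder $\operatorname{bin}(\Phi)$ of an ETF $\Phi=(\varphi_n)_{n\in\mathcal{N}}$ is the set of all $\mathcal{K}\subseteq\mathcal{N}$ such that $(\varphi_n)_{n\in\mathcal{K}}$ is a regular simplex. Symplectic ETF (for $P=2$): a finite sequence $\Phi=(\varphi_v)_{v\in\mathcal{V}}$ in a real Hilbert space with $\langle\varphi_v,\varphi_v\rangle=2^J+1$ and $\langle\varphi_{v_1},\varphi_{v_2}\rangle=(-1)^{\mathrm{B}(v_1,v_2)}$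 for $v_1\neq v_2$. Such a $\Phi$ exists and is a $2^{2J}$-vector ETF whose span has dimension $2^{J-1}(2^J+1)$. BIBDs: a BIBD consists of a finite vertex set and a finite nonempty sequence of subsets (blocks), all of the same size $K\geq2$, such that for some $\Lambda$ any two distinct vertices are contained together in exactly $\Lambda$ blocks. $\operatorname{bin}(\Phi)$ forms a BIBD if an enumeration of it without repetition is the block sequence of a BIBD with vertex set $\mathcal{V}$. *)

(* Defs.v *)
From mathcomp Require Import all_boot all_order all_algebra all_field.
From mathcomp Require Import boolp reals normedtype.

Set Implicit Arguments.
Unset Strict Implicit.
Unset Printing Implicit Defensive.

Import Order.TTheory GRing.Theory Num.Theory.
Import numFieldNormedType.Exports.

Local Open Scope ring_scope.

Section Symplectic.
Variables (F : fieldType) (V : vectType F) (B : {biscalar V}).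

Definition symplectic_form : Prop :=
  (forall v, B v v = 0) /\ (forall u, (forall v, B u v = 0) -> u = 0).

Definition symplectic_basis4 (v1 v2 v3 v4 : V) : Prop :=
  [/\ basis_of fullv [:: v1; v2; v3; v4],
      B v1 v2 = 1 /\ B v3 v4 = 1,
      B v1 v3 = 0 /\ B v1 v4 = 0 &
      B v2 v3 = 0 /\ B v2 v4 = 0].

End Symplectic.

Section Span.
Variables (R : realType) (H : lmodType R).

Definition in_span (N : finType) (phi : N -> H) (y : H) : Prop :=
  exists c : N -> R, y = \sum_n c n *: phi n.

Definition lin_indep (N : finType) (phi : N -> H) : Prop :=
  forall c : N -> R, \sum_n c n *: phi n = 0 -> forall n, c n = 0.

(* [H] may be infinite dimensional, so [\dim] is not available. *)
Definition span_has_dim (N : finType) (phi : N -> H) (d : nat) : Prop :=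
  exists b : 'I_d -> H,
    lin_indep b /\ (forall y, in_span phi y <-> in_span b y).

End Span.

Section Frames.
Variables (R : realType) (H : completeNormedModType R).

(* A real Hilbert space is a complete normed space [H] together with an inner
   product [ip] that induces its norm. *)
Definition hilbert_inner (ip : {dot H for idfun}) : Prop :=
  forall x : H, `|x| ^+ 2 = ip x x.

Variable ip : {dot H for idfun}.

Definition is_etf (N : finType) (phi : N -> H) : Prop :=
  [/\ (0 < #|N|)%N,
      exists2 S : R, 0 < S & forall n, `|phi n| ^+ 2 = S,
      exists2 C : R, 0 < C &
        forall n1 n2, n1 != n2 -> `|ip (phi n1) (phi n2)| ^+ 2 = C &
      exists2 A : R, 0 < A &
        forall y, in_span phi y -> \sum_n ip (phi n) y *: phi n = A *: y].

Definition subfamily (N : finType) (phi : N -> H) (K : {set N}) :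
  {n : N | n \in K} -> H := fun n => phi (val n).

Definition is_regular_simplex (N : finType) (phi : N -> H) (K : {set N}) :
  Prop :=
  is_etf (subfamily phi (K := K)) /\
  span_has_dim (subfamily phi (K := K)) #|K|.-1.

Definition binder (N : finType) (phi : N -> H) : {set {set N}} :=
  [set K : {set N} | `[< is_regular_simplex phi K >]].

(* The exponent of -1 is the representative 0 or 1 of [B v1 v2 : 'F_2]. *)
Definition is_symplectic_etf (J : nat) (V : vectType 'F_2) (B : {biscalar V})
    (phi : finvect_type V -> H) : Prop :=
  (forall v, ip (phi v) (phi v) = 2 ^+ J + 1) /\
  (forall v1 v2, v1 != v2 ->
     ip (phi v1) (phi v2) = (-1) ^+ nat_of_ord (B v1 v2)).

End Frames.

Section Designs.
Variable X : finType.

Definition is_bibd (blocks : seq {set X}) : Prop :=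
  blocks <> [::] /\
  exists K L : nat,
    [/\ (2 <= K)%N,
        forall b, b \in blocks -> #|b| = K &
        forall x y, x != y ->
          count (fun b : {set X} => (x \in b) && (y \in b)) blocks = L].

Definition forms_bibd (D : {set {set X}}) : Prop :=
  exists blocks : seq {set X}, [/\ uniq blocks, blocks =i D & is_bibd blocks].

End Designs.

Section Blocks.
Variable V : vectType 'F_2.
Notation fV := (finvect_type V).

Definition translate (v : fV) (K : {set fV}) : {set fV} :=
  [set v + x | x in K].

Definition base_block (v1 v2 v3 v4 : fV) : {set fV} :=
  [set 0; v1; v2; v1 + v2 + v3; v1 + v2 + v4; v1 + v2 + v3 + v4].

End Blocks.

(* Main.v *)
Require Import Defs.
From mathcomp Require Import all_boot all_order all_algebra all_field.
From mathcomp Require Import boolp reals normedtype.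
From mathcomp Require Import zify ring lra.

(* If K is a regular simplex of size n, its Gram matrix G satisfies
   A - G = (rank one) for the frame constant A; as the diagonal of G is 2^J + 1
   and its other entries are signs, this forces n = 2^J + 2 and
   G_xy G_yz G_zx = -1 for distinct x, y, z, i.e.
   B(x,y) + B(y,z) + B(z,x) = 1. Conversely such a K is a regular simplex.
   Translating K so that it contains 0 turns K \ {0} into 2^J + 1 vectors with
   pairwise form 1. An even number of such vectors is linearly independent, so
   2^J + 1 <= 2J + 1 and J <= 2. For J = 2, in the coordinates of a symplectic
   basis the claims are finite statements about F_2^4: the base block is a
   (16,6,2) difference set whose translates are all the possible K. *)

Set Implicit Arguments.
Unset Strict Implicit.
Unset Printing Implicit Defensive.

Import Order.TTheory GRing.Theory Num.Theory.
Import numFieldNormedType.Exports.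

Local Open Scope ring_scope.

(** * Sums over finite types, spans and linear relations *)

Lemma big_sub_neq (R : zmodType) (N : finType) (k : N) (F : N -> R) :
  \sum_(n | n != k) F n = \sum_(t : {n | n != k}) F (val t).
Proof. exact: (big_sub [pred n | n != k]). Qed.

Lemma sum_enum_val (R : zmodType) (N : finType) (F : N -> R) :
  \sum_n F n = \sum_(i < #|N|) F (enum_val i).
Proof. exact: (reindex _ (onW_bij _ (@enum_val_bij N))). Qed.

Section Span.
Variables (R : realType) (H : lmodType R).

Lemma in_span_self (N : finType) (phi : N -> H) n :
  in_span phi (phi n).
Proof.
exists (fun k => (k == n)%:R); rewrite (bigD1 n) //= eqxx scale1r.
by rewrite big1 ?addr0 // => k /negPf->; rewrite scale0r.
Qed.

(** A basis indexed by any finite type can be renumbered by ordinals through its enumeration. *)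
Lemma span_has_dimW (N T : finType) (phi : N -> H) (b : T -> H) :
    lin_indep b -> (forall y, in_span phi y <-> in_span b y) ->
  span_has_dim phi #|T|.
Proof.
move=> b_free b_span; exists (b \o enum_val); split=> [c c0 i|y].
  pose d t := c (enum_rank t).
  suff /b_free/(_ (enum_val i)) : \sum_t d t *: b t = 0 by rewrite /d enum_valK.
  by rewrite sum_enum_val -[RHS]c0; apply: eq_bigr => j _; rewrite /d enum_valK.
rewrite b_span; split=> -[c ->].
  by exists (c \o enum_val); rewrite sum_enum_val.
exists (c \o enum_rank); rewrite [RHS]sum_enum_val.
by apply: eq_bigr => j _ /=; rewrite enum_valK.
Qed.

(* With b a basis of the span, phi = M b and b = L phi force L M = 1, so M has
   full column rank and its left kernel is a line. *)
Lemma relation_line (N : finType) (phi : N -> H) :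
    (0 < #|N|)%N -> span_has_dim phi #|N|.-1 ->
  exists c : N -> R,
    [/\ exists n, c n != 0, \sum_n c n *: phi n = 0 &
        forall d, \sum_n d n *: phi n = 0 -> exists t, forall n, d n = t * c n].
Proof.
move=> N_gt0 [b [b_free b_span]].
have phiE n : exists m : 'I_#|N|.-1 -> R, phi n = \sum_j m j *: b j.
  exact/b_span/in_span_self.
have bE j : exists l : N -> R, b j = \sum_n l n *: phi n.
  exact/b_span/in_span_self.
have [m mE] := choice phiE; have [l lE] := choice bE.
pose M := \matrix_(i < #|N|, j < #|N|.-1) m (enum_val i) j.
pose L := \matrix_(j < #|N|.-1, i < #|N|) l j (enum_val i).
pose rowof (d : N -> R) := \row_(i < #|N|) d (enum_val i).
have sumE d : \sum_n d n *: phi n = \sum_j (rowof d *m M) 0 j *: b j.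
  under eq_bigr => n _ do rewrite mE scaler_sumr.
  rewrite exchange_big /=; apply: eq_bigr => j _.
  rewrite mxE scaler_suml sum_enum_val.
  by apply: eq_bigr => i _; rewrite !mxE scalerA.
have kerE d : \sum_n d n *: phi n = 0 <-> rowof d *m M = 0.
  rewrite sumE; split=> [/b_free d0|->].
    by apply/rowP => j; rewrite d0 mxE.
  by rewrite big1 // => j _; rewrite mxE scale0r.
(* Substitute [phi = M b] into [b = L phi] and compare coefficients over the independent [b]. *)
have LM : L *m M = 1%:M.
  apply/matrixP => j j'; apply/eqP; rewrite -subr_eq0; apply/eqP.
  move: j'; apply: b_free.
  under eq_bigr => j' _ do rewrite scalerBl.
  rewrite sumrB; apply/eqP; rewrite subr_eq0; apply/eqP.
  transitivity (b j); last first.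
    rewrite (bigD1 j) //= mxE eqxx scale1r big1 ?addr0 // => k.
    by rewrite mxE eq_sym => /negPf->; rewrite scale0r.
  rewrite [RHS]lE sumE; apply: eq_bigr => k _; congr (_ *: _).
  by rewrite !mxE; apply: eq_bigr => i _; rewrite !mxE.
have rkM : \rank M = #|N|.-1.
  apply/eqP; rewrite eqn_leq rank_leq_col /=.
  by have := mxrankM_maxr L M; rewrite LM mxrank1.
have rkK : \rank (kermx M) = 1%N.
  by rewrite mxrank_ker rkM; case: #|N| N_gt0 => // n _; rewrite subSnn.
have /rowV0Pn[v vK v0] : kermx M != 0 by rewrite -mxrank_eq0 rkK.
have rowofK (w : 'rV[R]_#|N|) : rowof (fun n => w 0 (enum_rank n)) = w.
  by apply/rowP => i; rewrite mxE enum_valK.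
exists (fun n => v 0 (enum_rank n)); split.
- apply/existsP; apply: contraNT v0 => /existsPn v0; apply/eqP/rowP => i.
  by have /negPn/eqP := v0 (enum_val i); rewrite enum_valK mxE.
- by apply/kerE; rewrite rowofK; exact/sub_kermxP.
- move=> d /kerE /sub_kermxP dK.
  have /sub_rVP[t dE] : (rowof d <= v)%MS.
    apply: submx_trans dK _.
    by rewrite -(geq_leqif (mxrank_leqif_sup vK)) rkK rank_rV v0.
  exists t => n; have := congr1 (fun w : 'rV_#|N| => w 0 (enum_rank n)) dE.
  by rewrite !mxE enum_rankK.
Qed.

End Span.

(** * Gram matrices of regular simplices *)

Section Frames.
Variables (R : realType) (H : completeNormedModType R).
Variable ip : {dot H for idfun}.

Lemma ipC x y : ip x y = ip y x.
Proof. by rewrite [LHS]hermitian_subproof expr0 mul1r. Qed.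

Lemma ip_suml (N : finType) (c : N -> R) (phi : N -> H) y :
  ip (\sum_n c n *: phi n) y = \sum_n c n * ip (phi n) y.
Proof. by rewrite linear_sumlz; apply: eq_bigr => n _; rewrite linearZl_LR. Qed.

Lemma ip_eq0 x : ip x x = 0 -> x = 0.
Proof.
move=> x0; apply/eqP; apply/negPn/negP => /(@neq0_dnorm_gt0 _ _ _ ip).
by rewrite x0 ltxx.
Qed.

Section Gram.
Variables (N : finType) (phi : N -> H) (S : R).
Hypotheses (ipE : hilbert_inner ip) (S_gt0 : 0 < S).
Hypothesis normE : forall n, ip (phi n) (phi n) = S.
Hypothesis gramE : forall m n, m != n -> ip (phi m) (phi n) ^+ 2 = 1.

(* Every column of A - Gram is a linear relation, hence a multiple of the
   unique relation c: A - Gram = c t^T has rank one. *)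
Lemma regular_simplex_gram :
    is_etf ip phi -> span_has_dim phi #|N|.-1 ->
  #|N|%:R = S + 1 /\
  forall x y z, x != y -> y != z -> z != x ->
    ip (phi x) (phi y) * ip (phi y) (phi z) * ip (phi z) (phi x) = - 1.
Proof.
case=> N_gt0 _ _ [A A_gt0 tight] /(relation_line N_gt0)[c [[k ck0] c0 cU]].
have tP m : exists t, forall n, (n == m)%:R * A - ip (phi n) (phi m) = t * c n.
  apply: cU; under eq_bigr => n _ do rewrite scalerBl.
  rewrite sumrB tight; last exact: in_span_self.
  rewrite (bigD1 m) //= eqxx mul1r big1 ?addr0 ?subrr // => n /negPf->.
  by rewrite mul0r scale0r.
have [t tE] := choice tP.
have diagE n : t n * c n = A - S by rewrite -tE eqxx mul1r normE.
have offE m n : m != n -> ip (phi m) (phi n) = - (t n * c m).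
  by move=> /negPf mn; rewrite -tE mn mul0r sub0r opprK.
have symE m n : t n * c m = t m * c n.
  have [->//|mn] := eqVneq m n.
  apply: oppr_inj; rewrite -(offE _ _ mn) ipC; apply: offE.
  by rewrite eq_sym.
(* The Gram matrix kills [c], so [c] is an eigenvector of A - Gram for [A]; in rank one this
   eigenvalue is the trace. *)
have AE : A = #|N|%:R * (A - S).
  apply: (mulIf ck0).
  have -> : A * c k = \sum_n c n * (t k * c n).
    under eq_bigr => n _ do rewrite -tE mulrBr.
    rewrite sumrB -ip_suml c0 linear0l subr0 (bigD1 k) //= eqxx mul1r mulrC.
    by rewrite big1 ?addr0 // => n /negPf->; rewrite mul0r mulr0.
  transitivity (\sum_(n : N) (A - S) * c k).
    by apply: eq_bigr => n _; rewrite -symE -(diagE n); ring.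
  by rewrite sumr_const -mulrA mulr_natl.
have AS_gt0 : 0 < A - S.
  by have := A_gt0; rewrite {1}AE pmulr_rgt0 // ltr0n.
(* Two distinct indices give a vanishing 2 x 2 minor of A - Gram, so [(A - S) ^+ 2 = 1]. A single
   index would give [A = A - S], against [S > 0]. *)
have AS1 : A - S = 1.
  case: (pickP (predC1 k)) => [n /= nk|no].
    have : (A - S) ^+ 2 = 1.
      rewrite -(gramE nk) (offE _ _ nk) sqrrN expr2 -{1}(diagE n) -(diagE k).
      by rewrite expr2 {2}symE; ring.
    move=> /eqP; rewrite sqrf_eq1 => /orP[/eqP//|/eqP AS].
    by move: AS_gt0; rewrite AS oppr_gt0 ltr10.
  have N1 : #|N| = 1%N.
    by rewrite -(card1 k); apply: eq_card => n;
       have /negbFE := no n; rewrite !inE.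
  by move: AE S_gt0; rewrite N1 => AE; lra.
have NE : #|N|%:R = S + 1 :> R by move: AE; rewrite AS1; lra.
split=> // x y z xy yz zx; rewrite !offE //.
transitivity (- ((t x * c x) * (t y * c y) * (t z * c z))); first by ring.
by rewrite !diagE AS1 !mul1r.
Qed.

(* Conversely the Gram matrix is (S + 1) I - e e^T for a sign vector e. *)
Lemma gram_regular_simplex :
    #|N|%:R = S + 1 ->
    (forall x y z, x != y -> y != z -> z != x ->
       ip (phi x) (phi y) * ip (phi y) (phi z) * ip (phi z) (phi x) = - 1) ->
  is_etf ip phi /\ span_has_dim phi #|N|.-1.
Proof.
move=> NE triple.
have N_gt0 : (0 < #|N|)%N by rewrite -(ltr0n R) NE addr_gt0.
have [k _] := card_gt0P N_gt0.
(* Normalised at the base point [k]; the triangle condition through [k] then makes the off-diagonal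
   entries equal to [- e m * e n]. *)
pose e n : R := if n == k then 1 else - ip (phi n) (phi k).
have ek : e k = 1 by rewrite /e eqxx.
have e2 n : e n * e n = 1.
  rewrite /e; case: eqVneq => [_|nk]; first by rewrite mulr1.
  by rewrite mulrNN -expr2 gramE.
have GE m n : ip (phi m) (phi n) = (m == n)%:R * (S + 1) - e m * e n.
  have [<-|mn] := eqVneq m n; first by rewrite normE e2 mul1r addrK.
  rewrite mul0r sub0r /e.
  have [mk|mk] := eqVneq m k; have [nk|nk] := eqVneq n k.
  - by rewrite mk nk eqxx in mn.
  - by rewrite mk ipC; ring.
  - by rewrite nk; ring.
  have := triple m n k mn nk; rewrite eq_sym => /(_ mk).
  rewrite (ipC (phi k)) => tr.
  transitivity (ip (phi m) (phi n) * ip (phi n) (phi k) ^+ 2 *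
                ip (phi m) (phi k) ^+ 2); first by rewrite !gramE // !mulr1.
  transitivity (ip (phi m) (phi n) * ip (phi n) (phi k) * ip (phi m) (phi k) *
                (ip (phi n) (phi k) * ip (phi m) (phi k))); first by ring.
  by rewrite tr; ring.
have gram_sum (c : N -> R) m :
    \sum_n c n * ip (phi n) (phi m) =
    (S + 1) * c m - e m * \sum_n c n * e n.
  under eq_bigr => n _ do rewrite GE mulrBr.
  rewrite sumrB (bigD1 m) //= eqxx big1 => [|n /negPf->]; last first.
    by rewrite mul0r mulr0.
  rewrite mulr_sumr mul1r addr0 mulrC; congr (_ - _).
  by apply: eq_bigr => n _; ring.
have sum_e2 : \sum_n e n * e n = S + 1.
  by under eq_bigr => n _ do rewrite e2; rewrite sumr_const NE.
(* The Gram matrix sends [e] to [(S + 1) e] minus [e] times the sum of the [e n * e n], which is 0;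
   so this combination has norm 0. *)
have rel : \sum_n e n *: phi n = 0.
  apply: ip_eq0; rewrite ip_suml big1 // => n _.
  by rewrite ipC ip_suml gram_sum sum_e2; ring.
have etf : is_etf ip phi.
  split=> //.
  - by exists S => // n; rewrite ipE.
  - by exists 1 => // m n mn; rewrite real_normK ?num_real // gramE.
  exists (S + 1); first by rewrite addr_gt0.
  move=> _ [c ->].
  under eq_bigr => n _ do rewrite ipC ip_suml gram_sum scalerBl.
  rewrite sumrB scaler_sumr.
  rewrite [X in _ - X](_ : _ = 0) ?subr0.
    by apply: eq_bigr => n _; rewrite scalerA.
  under eq_bigr => n _ do rewrite mulrC -scalerA.
  by rewrite -scaler_sumr rel scaler0.
split=> //.
(* As [e k = 1], the relation [rel] expresses [phi k] through the other vectors, which will form a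
   basis. *)
have -> : #|N|.-1 = #|{: {n | n != k}}|.
  by rewrite card_sig (cardC1 k).
apply: (@span_has_dimW _ _ _ _ _ (fun t => phi (val t))) => [c c0 t|y].
  (* Extend [c] by 0 at [k]: the Gram equation at [k] then forces the sum of the [d n * e n] to
     vanish, and the other equations give [d = 0]. *)
  pose d n := if insub n is Some t then c t else 0 : R.
  have d0 : \sum_n d n *: phi n = 0.
    rewrite (bigD1 k) //= {1}/d insubF ?eqxx // scale0r add0r big_sub_neq.
    by rewrite -[RHS]c0; apply: eq_bigr => u _; rewrite /d valK.
  have dE m : (S + 1) * d m = e m * \sum_n d n * e n.
    by apply/eqP; rewrite -subr_eq0 -gram_sum -ip_suml d0 linear0l.
  have dk : d k = 0 by rewrite /d insubF ?eqxx.
  have de : \sum_n d n * e n = 0.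
    by have := dE k; rewrite dk mulr0 ek mul1r.
  have := dE (val t); rewrite de mulr0 /d valK => /eqP.
  by rewrite mulf_eq0 gt_eqF ?addr_gt0 //= => /eqP.
split=> -[c ->].
  (* Subtracting [c k] times [rel] removes the term at [k]. *)
  exists (fun t => c (val t) - c k * e (val t)).
  rewrite -(big_sub_neq k (fun n => (c n - c k * e n) *: phi n)).
  transitivity (\sum_n (c n - c k * e n) *: phi n).
    under [RHS]eq_bigr => n _ do rewrite scalerBl -scalerA.
    by rewrite sumrB -scaler_sumr rel scaler0 subr0.
  by rewrite (bigD1 k) //= ek mulr1 subrr scale0r add0r.
exists (fun n => if insub n is Some t then c t else 0 : R).
rewrite [RHS](bigD1 k) //= insubF ?eqxx // scale0r add0r.
rewrite (big_sub_neq k).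
by apply: eq_bigr => t _; rewrite valK.
Qed.

End Gram.
End Frames.

(** * Alternating forms over F_2 and odd triangles *)

Lemma F2_eq01 (x : 'F_2) : x = 0 \/ x = 1.
Proof. by case: x => -[|[|//]] ?; [left | right]; exact: val_inj. Qed.

Lemma addxx_F2 (x : 'F_2) : x + x = 0.
Proof. by case: (F2_eq01 x) => ->; exact: val_inj. Qed.

Section AlternatingForm.
Variables (V : vectType 'F_2) (B : {biscalar V}).
Hypothesis altB : forall v, B v v = 0.
Notation fV := (finvect_type V).
Implicit Types (v x y z : fV) (K : {set fV}).

Lemma addvv v : v + v = 0.
Proof.
have : (1 + 1 : 'F_2) *: (v : V) = 0 by rewrite addxx_F2 scale0r.
by rewrite scalerDl scale1r.
Qed.

Lemma oppv v : - v = v.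
Proof. by apply/eqP; rewrite -subr_eq0 -opprD addvv oppr0. Qed.

Lemma BDl x y z : B (x + y) z = B x z + B y z.
Proof. exact: linearDl. Qed.

Lemma BDr x y z : B z (x + y) = B z x + B z y.
Proof. exact: linearDr. Qed.

Lemma alt_sym x y : B x y = B y x.
Proof.
have : B (x + y) (x + y) = 0 by exact: altB.
rewrite BDl !BDr !altB addr0 add0r => /eqP; rewrite addr_eq0 => /eqP->.
by case: (F2_eq01 (B y x)) => ->; exact: val_inj.
Qed.

(* The Gram matrix J - I of an even number of vectors is invertible mod 2. *)
Lemma free_pairwise1 (s : seq V) :
    uniq s -> ~~ odd (size s) ->
    {in s &, forall x y, x != y -> B x y = 1} -> free s.
Proof.
move=> s_uniq s_even s1; apply/(@freeP _ _ _ (in_tuple s)) => k.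
rewrite /= => k0.
(* Pairing the relation with the [j]-th vector kills only the [j]-th term: the other coefficients
   sum to 0, so each coefficient equals the total. *)
have kE j : k j = \sum_i k i.
  have : B (\sum_(i < size s) k i *: s`_i) s`_j = 0 by rewrite k0 linear0l.
  rewrite linear_sumlz (bigD1 j) //= linearZl_LR /= altB mulr0 add0r => kj.
  rewrite [RHS](bigD1 j) //= -[LHS]addr0 -[in LHS]kj; congr (_ + _).
  apply: eq_bigr => i ij; rewrite linearZl_LR /= s1 ?mem_nth ?mulr1 //.
  by rewrite nth_uniq.
(* The total is a sum of an even number of copies of itself, hence 0 mod 2. *)
move=> i; rewrite kE; transitivity (\sum_(j < size s) \sum_i k i).
  by apply: eq_bigr => j _; exact: kE.
rewrite sumr_const card_ord; move: (\sum_i k i) => T.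
rewrite -(odd_double_half (size s)) (negPf s_even) add0n.
by rewrite -mul2n mulrnA mulr2n addxx_F2 mul0rn.
Qed.

(** An even family of such vectors is free; an odd one becomes even after dropping one vector, which
    accounts for the extra 1. *)
Lemma card_pairwise1 (S : {set fV}) :
    (forall x y, x \in S -> y \in S -> x != y -> B x y = 1) ->
  (#|S| <= \dim {:V} + 1)%N.
Proof.
move=> S1; have enumS1 : {in enum S &, forall x y, x != y -> B x y = 1}.
  by move=> x y; rewrite !mem_enum; exact: S1.
have free_size (s : seq V) : free s -> (size s <= \dim {:V})%N.
  by move=> /eqP <-; exact/dimvS/subvf.
have [S_odd|S_even] := boolP (odd #|S|); last first.
  rewrite cardE in S_even *.
  have := free_pairwise1 (enum_uniq S : uniq (enum S : seq V)) S_even enumS1.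
  by move=> /free_size/leq_trans; apply; exact: leq_addr.
move: S_odd enumS1 (enum_uniq S); rewrite cardE.
case: (enum S) => //= x s /= s_even sS1 /andP[_ s_uniq].
rewrite addn1 ltnS; apply: (free_size s); apply: free_pairwise1 => // y z ys zs.
by apply: sS1; apply/orP; right.
Qed.

(** For Gram entries [(-1) ^+ B x y], this says that the three entries of every triangle have
    product -1. *)
Definition odd_triangles K : Prop :=
  forall x y z, x \in K -> y \in K -> z \in K -> x != y -> y != z -> z != x ->
    B x y + B y z + B z x = 1.

Lemma BD_triangle v x y :
  B (v + x) (v + y) = B x y + B y v + B v x.
Proof.
by rewrite !BDl !BDr altB add0r addrC [B x v]alt_sym [B v y]alt_sym; ring.
Qed.

(** Every vector is its own negative, so shifting back is shifting again. *)
Lemma mem_translate v K x : (x \in translate v K) = (v + x \in K).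
Proof.
apply/imsetP/idP => [[y yK ->]|vxK]; first by rewrite addrA addvv add0r.
by exists (v + x) => //; rewrite addrA addvv add0r.
Qed.

Lemma translateK v : involutive (translate v).
Proof.
by move=> K; apply/setP => x; rewrite !mem_translate addrA addvv add0r.
Qed.

Lemma translateD v w K : translate v (translate w K) = translate (v + w) K.
Proof. by apply/setP => x; rewrite !mem_translate addrA [w + v]addrC. Qed.

Lemma card_translate v K : #|translate v K| = #|K|.
Proof. by rewrite card_imset //; exact: addrI. Qed.

(** In the triangle sum of a shifted triple, each of [B v x], [B v y], [B v z] occurs twice and
    cancels mod 2. *)
Lemma odd_triangles_translate v K :
  odd_triangles K -> odd_triangles (translate v K).
Proof.
move=> oddK x y z; rewrite !mem_translate => xK yK zK xy yz zx.
rewrite -(oddK (v + x) (v + y) (v + z)) ?(inj_eq (addrI _)) //.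
rewrite !BD_triangle [B y v]alt_sym [B z v]alt_sym [B x v]alt_sym.
transitivity (B x y + B y z + B z x + (B v x + B v x) + (B v y + B v y) +
              (B v z + B v z)); last by ring.
by rewrite !addxx_F2 !addr0.
Qed.

(** [B x y] is the sum over the triangle [z + x], [z + y], [z]. *)
Lemma pairwise1_of_odd_triangles K z :
    odd_triangles K -> z \in K ->
    forall x y, x \in translate z K :\ 0 -> y \in translate z K :\ 0 ->
  x != y -> B x y = 1.
Proof.
move=> oddK zK x y; rewrite !inE !mem_translate => /andP[x0 xK] /andP[y0 yK] xy.
have neq w : w != 0 -> z + w != z.
  by move=> w0; rewrite -[X in _ != X]addr0 (inj_eq (addrI z)).
rewrite -(oddK (z + x) (z + y) z xK yK zK) ?neq //; last first.
- by rewrite eq_sym neq.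
- by rewrite (inj_eq (addrI z)).
rewrite BD_triangle BDl BDr !altB !add0r.
transitivity (B x y + (B y z + B y z) + (B z x + B z x)); last by ring.
by rewrite !addxx_F2 !addr0.
Qed.

(** One more than in [card_pairwise1], which is applied without the vertex shifted to 0. *)
Lemma odd_triangles_card K :
  odd_triangles K -> (0 < #|K|)%N -> (#|K| <= \dim {:V} + 2)%N.
Proof.
move=> oddK /card_gt0P[z zK].
have := card_pairwise1 (pairwise1_of_odd_triangles oddK zK).
rewrite [X in (X <= _)%N](_ : _ = #|K|.-1); first by lia.
have := cardsD1 0 (translate z K).
by rewrite mem_translate addr0 zK card_translate => ->.
Qed.

End AlternatingForm.

(** * Binder members as sets with odd triangles *)

Section Binder.
Variables (J : nat) (V : vectType 'F_2) (B : {biscalar V}).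
Variables (R : realType) (H : completeNormedModType R) (ip : {dot H for idfun}).
Variable phi : finvect_type V -> H.
Hypotheses (ipE : hilbert_inner ip) (etfP : is_symplectic_etf ip J B phi).

(** Here [S] is [2 ^ J + 1], so the simplex size [S + 1] is [2 ^ J + 2]; the sign condition on
    triangles passes to exponents mod 2. *)
Lemma in_binderP (K : {set finvect_type V}) :
  K \in binder ip phi <-> #|K| = (2 ^ J + 2)%N /\ odd_triangles B K.
Proof.
have [normE offE] := etfP.
have signE (a b c : 'F_2) :
    ((-1) ^+ nat_of_ord a * (-1) ^+ nat_of_ord b * (-1) ^+ nat_of_ord c
     == -1 :> R) = (a + b + c == 1).
  have neq : (1 == -1 :> R) = false by apply/eqP; lra.
  by case: (F2_eq01 a) => ->; case: (F2_eq01 b) => ->; case: (F2_eq01 c) => ->;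
    rewrite /= ?(expr0, expr1, mulN1r, opprK, mul1r) ?neq ?eqxx.
have S_gt0 : 0 < 2 ^+ J + 1 :> R by rewrite addr_gt0 ?exprn_gt0.
pose psi := subfamily phi (K := K).
have psiN n : ip (psi n) (psi n) = 2 ^+ J + 1 by exact: normE.
have psiO m n : m != n -> ip (psi m) (psi n) ^+ 2 = 1.
  by move=> mn; rewrite offE // -exprM mulnC exprM sqrrN !expr1n.
have cardK : #|{: {n | n \in K}}| = #|K| by rewrite card_sig.
have cardE : #|K|%:R = 2 ^+ J + 1 + 1 :> R <-> #|K| = (2 ^ J + 2)%N.
  have -> : 2 ^+ J + 1 + 1 = (2 ^ J + 2)%:R :> R by rewrite natrD natrX; ring.
  by split=> [/eqP|->//]; rewrite eqr_nat => /eqP.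
rewrite inE asboolE /is_regular_simplex -cardK; split.
  case=> etf dim; have [] := regular_simplex_gram S_gt0 psiN psiO etf dim.
  rewrite cardK => /cardE -> tri; split=> // x y z xK yK zK xy yz zx.
  have := tri (exist _ x xK) (exist _ y yK) (exist _ z zK) xy yz zx.
  by rewrite !offE // => /eqP; rewrite signE => /eqP.
case; rewrite cardK => /cardE NE tri; rewrite -cardK.
apply: (gram_regular_simplex ipE S_gt0 psiN psiO); first by rewrite cardK.
move=> x y z xy yz zx; apply/eqP; rewrite !offE // signE; apply/eqP.
by apply: tri => //; exact: valP.
Qed.

End Binder.

(** * Finite checks in F_2^4 *)

(* A vector of F_2^4, as its coordinates in a symplectic basis. *)
Notation word := (bool * bool * bool * bool)%type.

(** An explicit list of all words, so that quantified statements become booleans to evaluate. *)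
Definition cube : seq word :=
  let bits := [:: false; true] in
  [seq (x, d) | x <- [seq (x, c) | x <- [seq (a, b) | a <- bits, b <- bits],
                                   c <- bits],
                d <- bits].

Definition word0 : word := (false, false, false, false).

Definition word_add (x y : word) : word :=
  let: (a, b, c, d) := x in let: (a', b', c', d') := y in
  (a (+) a', b (+) b', c (+) c', d (+) d').

(** The form of a symplectic basis: an orthogonal sum of two hyperbolic planes. *)
Definition word_form (x y : word) : bool :=
  let: (a, b, c, d) := x in let: (a', b', c', d') := y in
  (a && b') (+) (b && a') (+) ((c && d') (+) (d && c')).

(** Coordinates of the elements of [base_block], in the same order. *)
Definition word_block : seq word :=
  [:: word0; (true, false, false, false); (false, true, false, false);
      (true, true, true, false); (true, true, false, true);
      (true, true, true, true)].

Lemma mem_cube x : x \in cube.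
Proof. by move: x => [[[[] []] []] []]. Qed.

Lemma all_cube (P : pred word) : all P cube -> forall x, P x.
Proof. by move=> /allP P_ x; apply/P_/mem_cube. Qed.

Lemma card_word (P : pred word) : #|P| = count P cube.
Proof.
rewrite -size_filter -(card_uniqP (filter_uniq _ _)) //.
by apply: eq_card => x; rewrite mem_filter mem_cube andbT.
Qed.

Lemma word_form_nondegenerate x y :
  (forall z, word_form x z = word_form y z) -> x = y.
Proof.
have check : all (fun x => all (fun y =>
    (x == y) || has (fun z => word_form x z != word_form y z) cube) cube) cube.
  by vm_compute.
move=> xy; have := all_cube (all_cube check x) y.
by case/orP => [/eqP //|/hasP[z _]]; rewrite xy eqxx.
Qed.

Lemma word_block_odd_triangles :
  {in word_block & &, forall x y z, x != y -> y != z -> z != x ->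
    word_form x y (+) word_form y z (+) word_form z x}.
Proof.
have check : all (fun x => all (fun y => all (fun z =>
    [|| x == y, y == z, z == x |
        word_form x y (+) word_form y z (+) word_form z x])
    word_block) word_block) word_block by vm_compute.
move=> x y z xw yw zw /negPf xy /negPf yz /negPf zx.
have /allP/(_ _ xw)/allP/(_ _ yw)/allP/(_ _ zw) := check.
by rewrite xy yz zx.
Qed.

Lemma word_block_translate_inj s t :
  (forall x, (word_add s x \in word_block) = (word_add t x \in word_block)) ->
  s = t.
Proof.
have check : all (fun s => all (fun t => (s == t) || has (fun x =>
    (word_add s x \in word_block) != (word_add t x \in word_block)) cube)
    cube) cube by vm_compute.
move=> st; have := all_cube (all_cube check s) t.
by case/orP => [/eqP //|/hasP[x _]]; rewrite st eqxx.
Qed.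

(** As words are their own negatives, this counts the translates containing both [x] and [y]; the
    value 2 is the parameter Lambda of the design. *)
Lemma word_block_difference_set x y : x != y ->
  count (fun t => (word_add t x \in word_block) &&
                  (word_add t y \in word_block)) cube = 2%N.
Proof.
have check : all (fun x => all (fun y => (x == y) ||
    (count (fun t => (word_add t x \in word_block) &&
                     (word_add t y \in word_block)) cube == 2%N)) cube) cube.
  by vm_compute.
move=> /negPf xy; have := all_cube (all_cube check x) y.
by rewrite xy => /eqP.
Qed.

(** The hypotheses say that 0 and the five words have odd triangles. The nested conditionals prune
    the search; inclusion is enough, as cardinalities agree when this is applied. *)
Lemma word_block_unique a b c d e :
    word_form a b -> word_form a c -> word_form b c ->
    word_form a d -> word_form b d -> word_form c d ->
    word_form a e -> word_form b e -> word_form c e -> word_form d e ->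
  exists t,
    {in word_block, forall x, word_add t x \in [:: word0; a; b; c; d; e]}.
Proof.
have check : all (fun a => all (fun b => if word_form a b then
    all (fun c => if word_form a c && word_form b c then
    all (fun d => if [&& word_form a d, word_form b d & word_form c d] then
    all (fun e => if [&& word_form a e, word_form b e, word_form c e
                       & word_form d e] then
      has (fun t => all (fun x =>
        word_add t x \in [:: word0; a; b; c; d; e]) word_block) cube
    else true) cube else true) cube else true) cube else true) cube) cube.
  by vm_compute.
move=> ab ac bc ad bd cd ae be ce de.
have := all_cube (all_cube check a) b; rewrite ab => /all_cube/(_ c).
rewrite ac bc => /all_cube/(_ d); rewrite ad bd cd => /all_cube/(_ e).
by rewrite ae be ce de => /hasP[t _ /allP]; exists t.
Qed.

(** * Symplectic bases in dimension four and their coordinates *)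

Section SymplecticBasis.
Variables (V : vectType 'F_2) (B : {biscalar V}).
Hypotheses (dimV : \dim {:V} = 4%N) (symplB : symplectic_form B).
Notation fV := (finvect_type V).

Let altB : forall v, B v v = 0 := symplB.1.

(** Symplectic Gram-Schmidt: a hyperbolic pair, then a second one in its orthogonal complement. *)
Lemma symplectic_basis4_exists :
  exists v1 v2 v3 v4 : V, symplectic_basis4 B v1 v2 v3 v4.
Proof.
have pair (u : fV) : u != 0 -> exists w : fV, B u w = 1.
  move=> u0; suff /existsP[w /eqP] : [exists w : fV, B u w == 1] by exists w.
  apply: contraNT u0 => /existsPn Bu; apply/eqP/(symplB.2 u) => w.
  by have := Bu w; case: (F2_eq01 (B u w)) => ->.
have span_lt (s : seq V) : (size s < 4)%N -> exists w : fV, w \notin <<s>>%VS.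
  move=> s4.
  suff /existsP[w ?] : [exists w : fV, w \notin <<s>>%VS] by exists w.
  apply: contraTT s4 => /existsPn ws; rewrite -leqNgt -dimV.
  apply: leq_trans (dim_span s); apply: dimvS; apply/subvP => w _.
  exact/negPn/ws.
have [v1 v1N] : exists v1 : fV, v1 != 0.
  by have [w ws] := span_lt [::] isT; exists w; rewrite span_nil memv0 in ws.
have [v2 B12] := pair _ v1N.
have B21 : B v2 v1 = 1 by rewrite alt_sym.
(* Projection to the orthogonal complement of [v1] and [v2], with signs dropped in characteristic
   2. *)
pose proj (w : fV) : fV := w + B w v2 *: v1 + B w v1 *: v2.
have proj1 w : B v1 (proj w) = 0.
  rewrite !BDr /= !linearZr_LR /= altB B12 mulr0 mulr1 addr0 alt_sym //.
  exact: addxx_F2.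
have proj2 w : B v2 (proj w) = 0.
  rewrite !BDr /= !linearZr_LR /= altB B21 mulr0 mulr1 addr0 alt_sym //.
  exact: addxx_F2.
have [w ws] := span_lt [:: v1 : V; v2 : V] isT.
have v3N : proj w != 0.
  apply: contraNneq ws => /eqP; rewrite /proj -addrA addr_eq0 oppv => /eqP w0.
  rewrite [X in X \in _]w0; apply: (@memvD _ V); apply: (@memvZ _ V);
    by apply: memv_span; rewrite !inE eqxx ?orbT.
have [u B3u] := pair _ v3N.
exists v1, v2, (proj w), (proj u).
(* [proj w] is orthogonal to [v1] and [v2], so projecting [u] keeps their pairing. *)
have B34 : B (proj w) (proj u) = 1.
  by rewrite {2}/proj !BDr !linearZr_LR /= B3u !(alt_sym altB (proj w))
             proj1 proj2 !mulr0 !addr0.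
split=> //; rewrite basisEfree dimV subvf leqnn !andbT.
apply/(@freeP _ _ _ [tuple (v1 : V); v2 : V; proj w : V; proj u : V]) => k.
rewrite !big_ord_recl big_ord0 /= addr0 => k0.
have Bk z : k ord0 * B v1 z + (k (lift ord0 ord0) * B v2 z +
     (k (lift ord0 (lift ord0 ord0)) * B (proj w) z +
      k (lift ord0 (lift ord0 (lift ord0 ord0))) * B (proj u) z)) = 0.
  by rewrite -!linearZl_LR -!linearDl k0 linear0l.
have B3i := alt_sym altB (proj w); have B4i := alt_sym altB (proj u).
(* Pairing with the partner of a basis vector isolates its coefficient. *)
have k1 := Bk v2; have k2 := Bk v1.
have k3 := Bk (proj u); have k4 := Bk (proj w).
rewrite B12 altB B3i proj2 B4i proj2 !mulr0 mulr1 !addr0 in k1.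
rewrite B21 altB B3i proj1 B4i proj1 !mulr0 mulr1 !addr0 add0r in k2.
rewrite !proj1 !proj2 altB B34 !mulr0 mulr1 !addr0 !add0r in k3.
rewrite !proj1 !proj2 altB B4i B34 !mulr0 mulr1 !add0r in k4.
move=> i; case: i => -[|[|[|[|//]]]] ilt; [move: k1|move: k2|move: k3|move: k4];
  by move=> <-; congr (k _); exact: val_inj.
Qed.

Section Coordinates.
Variables v1 v2 v3 v4 : fV.
Hypothesis basis : symplectic_basis4 B v1 v2 v3 v4.

Definition lin_comb (x : word) : fV :=
  let: (a, b, c, d) := x in v1 *+ a + v2 *+ b + v3 *+ c + v4 *+ d.

Lemma lin_combD x y : lin_comb (word_add x y) = lin_comb x + lin_comb y.
Proof.
have mulD (v : fV) (a b : bool) : v *+ (a (+) b) = v *+ a + v *+ b.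
  by case: a; case: b; rewrite ?mulr1n ?mulr0n ?addr0 ?add0r ?addvv.
move: x y => [[[a b] c] d] [[[a' b'] c'] d'] /=.
by rewrite !mulD (addrACA (v1 *+ a)) (addrACA (v1 *+ a + v2 *+ b))
           (addrACA (v1 *+ a + v2 *+ b + v3 *+ c)).
Qed.

Lemma lin_comb_form x y : B (lin_comb x) (lin_comb y) = (word_form x y)%:R.
Proof.
have [_ [B12 B34] [B13 B14] [B23 B24]] := basis.
have sym := alt_sym altB.
have Mnl v w (a : bool) : B (v *+ a) w = B v w *+ a by exact: linearMnl.
have Mnr v w (a : bool) : B w (v *+ a) = B w v *+ a by exact: linearMnr.
move: x y => [[[a b] c] d] [[[a' b'] c'] d'].
rewrite /lin_comb !BDl !BDr !Mnl !Mnr !altB (sym v2 v1) (sym v3 v1) (sym v3 v2).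
rewrite (sym v4 v1) (sym v4 v2) (sym v4 v3) B12 B34 B13 B14 B23 B24.
rewrite !mul0rn !addr0 !add0r /=.
by case: a b c d a' b' c' d' => -[] [] [] [] [] [] []; exact: val_inj.
Qed.

(** Equal combinations pair equally with every [lin_comb z], and [word_form] is nondegenerate. *)
Lemma lin_comb_inj : injective lin_comb.
Proof.
move=> x y xy; apply: word_form_nondegenerate => z.
have := lin_comb_form x z; rewrite xy lin_comb_form.
by case: (word_form x z); case: (word_form y z) => // /(congr1 val).
Qed.

Lemma lin_comb_onto v : exists x, v = lin_comb x.
Proof.
have [vP _ _ _] := basis.
have scaleE (a : 'F_2) (w : V) : a *: w = w *+ (a == 1).
  by case: (F2_eq01 a) => ->; rewrite ?scale0r ?mulr0n ?scale1r ?mulr1n.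
have := @coord_basis _ _ _ _ [tuple (v1 : V); v2 : V; v3 : V; v4 : V] v vP
  (memvf _).
rewrite !big_ord_recl big_ord0 /= !scaleE addr0 !addrA.
set a := _ == _; set b := _ == _; set c := _ == _; set d := _ == _ => vE.
by exists (a, b, c, d).
Qed.

Lemma lin_comb0 : lin_comb word0 = 0.
Proof. by rewrite /lin_comb /= !mulr0n !addr0. Qed.

Lemma base_blockE :
  base_block v1 v2 v3 v4 = [set x in map lin_comb word_block].
Proof.
by apply/setP => x; rewrite !inE /= !mulr1n !mulr0n !addr0 !add0r !orbA.
Qed.

Lemma lin_comb_base_block x :
  (lin_comb x \in base_block v1 v2 v3 v4) = (x \in word_block).
Proof. by rewrite base_blockE inE mem_map //; exact: lin_comb_inj. Qed.

Lemma card_base_block : #|base_block v1 v2 v3 v4| = 6%N.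
Proof.
rewrite base_blockE cardsE; apply/card_uniqP; rewrite map_inj_uniq //.
exact: lin_comb_inj.
Qed.

Lemma translate_base_block_inj :
  injective (fun v => translate v (base_block v1 v2 v3 v4)).
Proof.
move=> v w; have [s ->] := lin_comb_onto v; have [t ->] := lin_comb_onto w.
move=> st; congr lin_comb; apply: word_block_translate_inj => x.
by rewrite -!lin_comb_base_block !lin_combD -!mem_translate st.
Qed.

Lemma odd_triangles_base_block : odd_triangles B (base_block v1 v2 v3 v4).
Proof.
move=> x y z; have [x' ->] := lin_comb_onto x; have [y' ->] := lin_comb_onto y.
have [z' ->] := lin_comb_onto z.
rewrite !lin_comb_base_block !(inj_eq lin_comb_inj) !lin_comb_form.
move=> xw yw zw xy yz zx; have := word_block_odd_triangles xw yw zw xy yz zx.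
by do 3!case: word_form => //=; move=> _; exact: val_inj.
Qed.

(** Shifted by one of its vertices, [K] becomes 0 and five vectors of pairwise form 1, whose
    coordinates fall under [word_block_unique]. *)
Lemma translate_base_block_of_odd_triangles (K : {set fV}) :
    odd_triangles B K -> #|K| = 6%N ->
  exists v, K = translate v (base_block v1 v2 v3 v4).
Proof.
move=> oddK K6; have /card_gt0P[z zK] : (0 < #|K|)%N by rewrite K6.
have K1 := pairwise1_of_odd_triangles altB oddK zK.
have zK0 : 0 \in translate z K by rewrite mem_translate addr0.
have L5 : #|translate z K :\ 0| = 5%N.
  by have := cardsD1 0 (translate z K); rewrite zK0 card_translate K6 => -[].
have Lin x : x \in enum (translate z K :\ 0) -> x \in translate z K.
  by rewrite mem_enum !inE => /andP[].
have {}K1 x y : x \in enum (translate z K :\ 0) ->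
    y \in enum (translate z K :\ 0) -> x != y -> B x y = 1.
  by rewrite !mem_enum; exact: K1.
move: L5 Lin K1 (enum_uniq (translate z K :\ 0)); rewrite cardE.
move: (enum _) => [|a [|b [|c [|d [|e [|//]]]]]] //= _ Lin K1.
have [a' aE] := lin_comb_onto a; have [b' bE] := lin_comb_onto b.
have [c' cE] := lin_comb_onto c; have [d' dE] := lin_comb_onto d.
have [e' eE] := lin_comb_onto e.
rewrite !{}aE !{}bE !{}cE !{}dE !{}eE in Lin K1 *.
set L := [:: _; _; _; _; _] in Lin K1.
have {}K1 x y : lin_comb x \in L -> lin_comb y \in L ->
    lin_comb x != lin_comb y -> word_form x y.
  move=> xL yL xy; have := K1 _ _ xL yL xy; rewrite lin_comb_form.
  by case: word_form => // /(congr1 val).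
rewrite !inE !negb_or -!andbA.
move=> /and5P[ab ac ad ae /and5P[bc bd be cd /and3P[ce de _]]].
have [t tP] : exists t, {in word_block, forall x,
    word_add t x \in [:: word0; a'; b'; c'; d'; e']}.
  by apply: word_block_unique; apply: K1; rewrite // !inE eqxx ?orbT.
suff tE : base_block v1 v2 v3 v4 = translate (lin_comb t) (translate z K).
  by exists (z + lin_comb t); rewrite tE -translateD !translateK.
(* One inclusion suffices, as both sets have 6 elements. *)
apply/eqP; rewrite eqEcard !card_translate K6 card_base_block leqnn andbT.
apply/subsetP => x; have [x' ->] := lin_comb_onto x.
rewrite lin_comb_base_block mem_translate -lin_combD => /tP.
rewrite in_cons => /predU1P[->|xL]; first by rewrite lin_comb0.
by apply: Lin; rewrite -[L]/(map lin_comb [:: a'; b'; c'; d'; e']) map_f.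
Qed.

(** [x] lies in the translate by [v] exactly when [v + x] lies in the base block, so in coordinates
    this is the difference-set count. *)
Lemma base_block_design (x y : fV) : x != y ->
  #|[set v | (x \in translate v (base_block v1 v2 v3 v4)) &&
             (y \in translate v (base_block v1 v2 v3 v4))]| = 2%N.
Proof.
have [x' ->] := lin_comb_onto x; have [y' ->] := lin_comb_onto y.
rewrite (inj_eq lin_comb_inj) => xy.
apply: etrans (word_block_difference_set xy).
rewrite -card_word -(card_imset _ lin_comb_inj); apply: eq_card => v.
have [v' ->] := lin_comb_onto v.
by rewrite mem_imset ?inE ?mem_translate -?lin_combD ?lin_comb_base_block //;
   exact: lin_comb_inj.
Qed.

End Coordinates.
End SymplecticBasis.

(** * The size bound and its consequences for the binder *)

Theorem theorem4p8 (J : nat) (J_gt0 : (0 < J)%N)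
    (V : vectType 'F_2) (dimV : \dim {:V} = (2 * J)%N)
    (B : {biscalar V}) (symplB : symplectic_form B) :
  (forall S : {set finvect_type V},
     (forall v1 v2, v1 \in S -> v2 \in S -> v1 != v2 -> B v1 v2 = 1) ->
     (#|S| <= 2 * J + 1)%N)
  /\
  (forall (R : realType) (H : completeNormedModType R)
          (ip : {dot H for idfun}) (phi : finvect_type V -> H),
     hilbert_inner ip -> is_symplectic_etf ip J B phi ->
     (J <> 1%N -> J <> 2%N -> binder ip phi = set0)
     /\
     (J = 2%N ->
        [/\ binder ip phi != set0,
            forms_bibd (binder ip phi),
            (forall v1 v2 v3 v4 : V, symplectic_basis4 B v1 v2 v3 v4 ->
               binder ip phi =
                 [set translate v (base_block v1 v2 v3 v4)
                    | v : finvect_type V])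
          & (forall K : {set finvect_type V},
               K \in binder ip phi <->
               exists (v1 v2 v3 v4 v : V), symplectic_basis4 B v1 v2 v3 v4 /\
                 K = translate v (base_block v1 v2 v3 v4))])).
Proof.
have altB := symplB.1; split=> [S|R H ip phi ipE etfP].
  by rewrite -dimV; exact: card_pairwise1.
have binderP K := in_binderP ipE etfP K.
split=> [J1 J2|J2].
  apply/setP => K; rewrite in_set0; apply/negP => /binderP[cardK oddK].
  (* The simplex size [2 ^ J + 2] is at most [2 * J + 2]. *)
  have : (2 ^ J <= 2 * J)%N.
    rewrite -dimV -(leq_add2r 2) -cardK.
    by apply: odd_triangles_card => //; rewrite cardK addn2.
  suff : (2 * J < 2 ^ J)%N by lia.
  (* Only [J >= 3] remains, so the induction starts from 6 < 8. *)
  have -> : J = (J - 3 + 3)%N by lia.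
  by elim: (J - 3)%N => // n IHn; rewrite addSn expnS; lia.
have {}dimV : \dim {:V} = 4%N by rewrite dimV J2.
have {J2} binderP K : K \in binder ip phi <-> #|K| = 6%N /\ odd_triangles B K.
  by rewrite binderP J2.
have binderE (v1 v2 v3 v4 : V) : symplectic_basis4 B v1 v2 v3 v4 ->
    binder ip phi =
      [set translate v (base_block v1 v2 v3 v4) | v : finvect_type V].
  move=> basis; apply/setP => K; apply/idP/imsetP => [/binderP[K6 oddK]|].
    have [v ->] := translate_base_block_of_odd_triangles symplB basis oddK K6.
    by exists v.
  case=> v _ ->; apply/binderP; split.
    by rewrite card_translate (card_base_block symplB basis).
  apply: odd_triangles_translate => //.
  exact: (odd_triangles_base_block symplB basis).
have [v1 [v2 [v3 [v4 basis]]]] := symplectic_basis4_exists dimV symplB.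
have nonempty : binder ip phi != set0.
  apply/set0Pn; exists (translate 0 (base_block v1 v2 v3 v4)).
  by rewrite (binderE _ _ _ _ basis); apply/imsetP; exists 0.
split=> //.
- exists (enum (binder ip phi)); split; first exact: enum_uniq.
    by move=> K; rewrite mem_enum.
  split.
    by move=> enum0; case/set0Pn: nonempty => K; rewrite -mem_enum enum0.
  exists 6%N, 2%N; split=> // [K|x y xy].
    by rewrite mem_enum => /binderP[].
  apply: etrans (base_block_design symplB basis xy).
  (* Distinct shifts give distinct blocks, so blocks through both points are counted by their
     shifts. *)
  rewrite -(card_imset _ (translate_base_block_inj symplB basis)).
  rewrite -size_filter -(card_uniqP (filter_uniq _ (enum_uniq _))).
  apply: eq_card => K; rewrite mem_filter mem_enum (binderE _ _ _ _ basis).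
  apply/andP/imsetP => [[xyK /imsetP[v _ KE]]|[v]].
    by exists v => //; rewrite inE -KE.
  by rewrite inE => xyK ->; split=> //; apply/imsetP; exists v.
- move=> K; split=> [KB|[w1 [w2 [w3 [w4 [v [wbasis ->]]]]]]].
    move: KB; rewrite (binderE _ _ _ _ basis) => /imsetP[v _ ->].
    by exists v1, v2, v3, v4, v.
  by rewrite (binderE _ _ _ _ wbasis); apply/imsetP; exists v.
Qed.
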